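(* Let $a,b$ be positive integers. If $G$ is an $a$-path-pairable graph and $H$ is a $b$-path-pairable graph with $|V(G)|\geq 4\cdot\frac{(a+1)(b+1)}{2}-1$ and $|V(H)|\geq 4\cdot\frac{(a+1)(b+1)}{2}-1$, then the Cartesian product $G\square H$ is $k$-path-pairable for $k=\left\lfloor\frac{(a+1)(b+1)}{2}-1\right\rfloor$.
   Context: Graphs are finite, simple and undirected. For a positive integer $k$, a graph $G$ on at least $2k$ vertices is called $k$-path-pairable if, for any pair of disjoint sets of pairwise different vertices $X=\{x_1,\dots,x_k\}$ and $Y=\{y_1,\dots,y_k\}$ of $G$ (so $x_1,\dots,x_k,y_1,\dots,y_k$ are $2k$ distinct vertices), there exist $k$ pairwise edge-disjoint paths $P_1,\dots,P_k$ in $G$ such that $P_i$ joins $x_i$ to $y_i$. The Cartesian product $G\square H$ has vertex set $V(G)\times V(H)$, and $(x,u)(y,v)$ is an edge if $x=y$ and $uv\in E(H)$, or $xy\in E(G)$ and $u=v$. *)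

(* Defs.v *)
From mathcomp Require Import all_boot.

Set Implicit Arguments.
Unset Strict Implicit.
Unset Printing Implicit Defensive.

Record sgraph := SGraph {
  vertex :> finType;
  edge : rel vertex;
  edge_sym : symmetric edge;
  edge_irr : irreflexive edge }.

Arguments edge {s}.

Section CartesianProduct.
Variables G H : sgraph.

Definition cart_edge (p q : G * H) : bool :=
  (p.1 == q.1) && edge p.2 q.2 || edge p.1 q.1 && (p.2 == q.2).

Lemma cart_edge_sym : symmetric cart_edge.
Proof.
move=> p q; rewrite /cart_edge.
by rewrite (eq_sym p.1) (eq_sym p.2) (edge_sym p.1) (edge_sym p.2).
Qed.

Lemma cart_edge_irr : irreflexive cart_edge.
Proof. by move=> p; rewrite /cart_edge !edge_irr andbF. Qed.

Definition cart_prod : sgraph :=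
  @SGraph (G * H)%type cart_edge cart_edge_sym cart_edge_irr.

End CartesianProduct.

(* A path is given by its start x and the sequence p of its later vertices. *)
Definition joins (G : sgraph) (x y : G) (p : seq G) : bool :=
  [&& path edge x p, uniq (x :: p) & last x p == y].

(* Edges are undirected, hence recorded as unordered pairs. *)
Definition path_edges (G : sgraph) (x : G) (p : seq G) : seq {set G} :=
  pairmap (fun u v => [set u; v]) x p.

Definition path_pairable (k : nat) (G : sgraph) : Prop :=
  2 * k <= #|G| /\
  forall x y : 'I_k -> G,
    injective x -> injective y -> (forall i j, x i != y j) ->
    exists P : 'I_k -> seq G,
      (forall i, joins (x i) (y i) (P i)) /\
      (forall i j, i != j ->
         [disjoint path_edges (x i) (P i) & path_edges (x j) (P j)]).

(* Main.v *)
Require Import Defs.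
From mathcomp Require Import all_boot zify.

Set Implicit Arguments.
Unset Strict Implicit.
Unset Printing Implicit Defensive.

(** Think of the product as a grid: a row is a copy of [G] (second coordinate
    fixed), a column is a copy of [H] (first coordinate fixed).  Let [k] be the
    number of pairs to be joined; there are [2k < (a+1)(b+1)] terminals.  A
    column is heavy if it holds more than [b] terminals, so at most [a] columns
    are heavy, and hence each row contains at most [a] terminals lying in heavy
    columns.

    Spreading ([spread_columns]): inside each row, [a]-path-pairability of [G]
    moves all terminals lying in heavy columns to fresh columns, a different
    one for each terminal.  After that every column holds at most [b]
    terminals.

    Joining ([path_pairable_cart_prod]): each pair [i] receives a private row
    [w i] that contains no terminal.  Inside each column, [b]-path-pairability
    of [H] moves every terminal of pair [i] to row [w i], where the two ends
    are joined using the connectedness of [G].  If both ends of a pair have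
    come to the same column, their targets in that column would coincide; such a pair
    is instead joined directly inside the column, as one of its at most [b]
    requests.

    Different rows and columns have no edge in common, so all the pieces are
    edge-disjoint.  The terminals occupy at most [2k] columns and [2k] rows, so
    the [2k] fresh columns exist if [4k <= |G|], and the [k] private rows if
    [3k <= |H|].

    Concatenating pieces produces walks rather than paths.  For this reason
    the pieces are handled as symmetric relations, each a set of edges, in
    which the two ends are connected; a simple path is extracted only at the
    very end ([routing_path_pairable]). *)

(** * Auxiliary facts on finite types *)

Lemma fresh_injection (I T : finType) (A : {set T}) :
  #|I| + #|A| <= #|T| ->
  exists2 f : I -> T, injective f & forall i, f i \notin A.
Proof.
move=> leT; have leI : #|I| <= #|~: A|.
  by rewrite -(leq_add2r #|A|) (addnC #|~: A|) cardsC.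
exists (fun i => enum_val (widen_ord leI (enum_rank i))) => [i j|i].
  by move=> /enum_val_inj/(congr1 val)/= eq_ij; apply/enum_rank_inj/ord_inj.
by have := enum_valP (widen_ord leI (enum_rank i)); rewrite inE.
Qed.

Lemma connect_hom (T U : finType) (e : rel T) (e' : rel U) (f : T -> U) x y :
  {homo f : u v / e u v >-> e' u v} -> connect e x y ->
  connect e' (f x) (f y).
Proof.
move=> hom_f /connectP[p e_p ->].
elim: p x e_p => //= z p IHp x /andP[/hom_f/connect1 e_xz /IHp].
exact: connect_trans.
Qed.

(** * Routings by edge sets *)

(** Two vertices outside the given [2k] terminals serve as an additional
    pair, whose path is then discarded. *)
Lemma path_pairable_pred k G : path_pairable k.+1 G -> path_pairable k G.
Proof.
case=> leG ppG; split; first by apply: leq_trans leG; rewrite leq_mul2l leqnSn.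
move=> x y x_inj y_inj xy.
have [|f f_inj fN] := @fresh_injection bool G
  ([set x i | i : 'I_k] :|: [set y i | i : 'I_k]).
  rewrite card_bool (leq_trans _ leG) // mulnS leq_add2l.
  rewrite (leq_trans (leq_card_setU _ _)) //.
  by rewrite !card_imset // card_ord mul2n addnn.
have fx b i : x i != f b.
  by apply: contraNneq (fN b) => <-; rewrite inE imset_f.
have fy b i : y i != f b.
  by apply: contraNneq (fN b) => <-; rewrite inE (imset_f y) ?orbT.
pose ext (z : 'I_k -> G) b (i : 'I_k.+1) :=
  if unlift ord_max i is Some j then z j else f b.
have ext_inj z b : injective z -> (forall i, z i != f b) -> injective (ext z b).
  move=> z_inj zf i j; rewrite /ext.
  case: unliftP => [i'|] ->; case: unliftP => [j'|] -> //.
  - by move/z_inj->.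
  - by move/eqP; rewrite (negPf (zf _)).
  - by move/eqP; rewrite eq_sym (negPf (zf _)).
have [i j|P [P_joins P_dis]] :=
  ppG _ _ (ext_inj x false x_inj (fx _)) (ext_inj y true y_inj (fy _)).
  rewrite /ext.
  case: unliftP => [i'|] _; case: unliftP => [j'|] _ //; first by rewrite eq_sym.
  by rewrite (inj_eq f_inj).
have extE z b i : ext z b (lift ord_max i) = z i by rewrite /ext liftK.
exists (fun i => P (lift ord_max i)); split=> [i|i j ij].
  by have := P_joins (lift ord_max i); rewrite !extE.
have := P_dis (lift ord_max i) (lift ord_max j); rewrite !extE; apply.
by rewrite (inj_eq lift_inj).
Qed.

Lemma path_pairable_le k a G : k <= a -> path_pairable a G -> path_pairable k G.
Proof.
move/subnK <-; elim: (a - k) => // d IHd /path_pairable_pred; exact: IHd.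
Qed.

(** Edge-disjoint connections, given by the sets of edges that they may use
    instead of by paths: such connections compose by transitivity and unite
    without any bookkeeping of repeated vertices.  Requests outside [D] own no
    edge, which lets routings with different domains be glued together. *)
Record routing (G : sgraph) (I : finType) (D : {set I}) (s t : I -> G)
    (E : I -> rel G) : Prop := Routing {
  routing_sym : forall i, symmetric (E i);
  routing_edge : forall i, subrel (E i) edge;
  routing_supp : forall i u v, E i u v -> i \in D;
  routing_connect : forall i, i \in D -> connect (E i) (s i) (t i);
  routing_disjoint : forall i j u v, E i u v -> E j u v -> i = j }.

Arguments routing_edge {G I D s t E} _ i x y _.

Lemma path_in_edges (G : sgraph) (x : G) p :
  path edge x p ->
  path (fun u v => edge u v && ([set u; v] \in path_edges x p)) x p.
Proof.
move=> e_p.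
suff: forall S : {pred {set G}}, {subset path_edges x p <= S} ->
  path (fun u v => edge u v && ([set u; v] \in S)) x p by apply.
elim: p x e_p => //= y p IHp x /andP[-> /IHp{}IHp] S sub_S.
rewrite sub_S ?mem_head // IHp // => e e_p; apply: sub_S.
by rewrite inE e_p orbT.
Qed.

Lemma mem_path_edges (G : sgraph) (r : rel G) x p e :
  path r x p -> e \in path_edges x p -> exists u v, e = [set u; v] /\ r u v.
Proof.
elim: p x => //= y p IHp x /andP[r_xy /IHp{}IHp]; rewrite inE.
by case/predU1P => [->|/IHp//]; exists x, y.
Qed.

(** An [a]-path-pairable graph serves any family of at most [a] requests: it
    is also [#|D|]-path-pairable, so the elements of [D] can be numbered by
    ['I_#|D|]. *)
Lemma path_pairable_routing a (G : sgraph) (I : finType) (D : {set I})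
    (s t : I -> G) :
  path_pairable a G -> #|D| <= a ->
  {in D &, injective s} -> {in D &, injective t} ->
  {in D &, forall i j, s i != t j} ->
  exists E, routing D s t E.
Proof.
move=> ppG leD s_inj t_inj st; have [_ {}ppG] := path_pairable_le leD ppG.
have ev_inj (z : I -> G) : {in D &, injective z} ->
  injective (z \o @enum_val I (mem D)).
  by move=> z_inj i j /z_inj; rewrite !enum_valP => /(_ isT isT)/enum_val_inj.
have [i j|P [P_joins P_dis]] := ppG _ _ (ev_inj s s_inj) (ev_inj t t_inj).
  by apply: st; apply: enum_valP.
pose onpath k u v :=
  edge u v && ([set u; v] \in path_edges (s (enum_val k)) (P k)).
exists (fun i u v => [exists k, (enum_val k == i) && onpath k u v]); split.
- move=> i u v; apply: eq_existsb => k.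
  by rewrite /onpath edge_sym setUC.
- by move=> i u v /existsP[k /andP[_ /andP[]]].
- by move=> i u v /existsP[k /andP[/eqP<- _]]; apply: enum_valP.
- move=> i Di; have [k def_i] : exists k : 'I_#|D|, enum_val k = i.
    by exists (enum_rank_in Di i); rewrite enum_rankK_in.
  rewrite -{}def_i.
  have /and3P[e_p _ /eqP last_p] := P_joins k.
  apply/connectP; exists (P k) => //; apply: sub_path (path_in_edges e_p).
  by move=> u v uv; apply/existsP; exists k; rewrite eqxx.
- move=> i j u v /existsP[k /andP[/eqP<- /andP[_ uvk]]].
  case/existsP=> l /andP[/eqP<- /andP[_ uvl]].
  have [->//|kl] := eqVneq k l.
  by have /pred0P/(_ [set u; v])/=/andP[] := P_dis k l kl.
Qed.

Lemma path_pairable_connect a (G : sgraph) :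
  0 < a -> path_pairable a G -> forall u v : G, connect edge u v.
Proof.
move=> a_gt0 ppG u v; have [->|uv] := eqVneq u v; first exact: connect0.
have [||||E rE] := @path_pairable_routing a G unit setT (fun=> u) (fun=> v) ppG.
- by rewrite cardsT card_unit.
- by move=> [] [].
- by move=> [] [].
- by [].
have := routing_connect rE (in_setT tt).
by apply: (@connect_hom _ _ _ _ id) => x y; apply: (routing_edge rE tt).
Qed.

(** The converse passage: a walk inside the edge set [E i] can be shortened to
    a simple path with edges in [E i], and an unordered edge shared by two such
    paths would belong to both edge sets because these are symmetric. *)
Lemma routing_path_pairable k (G : sgraph) :
  2 * k <= #|G| ->
  (forall x y : 'I_k -> G, injective x -> injective y ->
     (forall i j, x i != y j) -> exists E, routing setT x y E) ->
  path_pairable k G.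
Proof.
move=> leG routeG; split=> // x y x_inj y_inj xy.
have [E rE] := routeG x y x_inj y_inj xy.
have ex_path i : exists p, joins (x i) (y i) p && path (E i) (x i) p.
  have /connectP[p e_p ->] := routing_connect rE (in_setT i).
  case/shortenP: e_p => q e_q uniq_q _; exists q; rewrite /joins e_q uniq_q eqxx.
  by rewrite (sub_path (routing_edge rE i) e_q).
have [P P_path] := fin_all_exists ex_path.
exists P; split=> [i|i j ij]; first by case/andP: (P_path i).
apply/pred0P => e /=; apply: contraNF ij => /andP[e_i e_j].
have /andP[_ /mem_path_edges/(_ e_i)[u [v [e_uv uv]]]] := P_path i.
have /andP[_ /mem_path_edges/(_ e_j)[u' [v' [e_uv' uv']]]] := P_path j.
apply/eqP/(routing_disjoint rE uv).
have : [set u; v] = [set u'; v'] by rewrite -e_uv.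
have v_neq : u' != v'.
  apply: contraTneq (routing_edge rE _ _ _ uv') => ->; by rewrite edge_irr.
move=> eq_e; have : u' \in [set u; v] by rewrite eq_e set21.
have : v' \in [set u; v] by rewrite eq_e set22.
rewrite !inE => /orP[]/eqP ev /orP[]/eqP eu; subst u' v' => //.
- by rewrite eqxx in v_neq.
- by rewrite (routing_sym rE).
- by rewrite eqxx in v_neq.
Qed.

(** * Emptying the heavy columns *)

(** Each row has at most one terminal in each of the at most [a] heavy
    columns, so its terminals to be moved can all be served within the row.
    Their new columns are fresh and distinct, so a column ends up with a single moved
    terminal or with the original at most [b] terminals of a column that is not
    heavy. *)
Lemma spread_columns a b (G H : sgraph) (T : finType) (pos : T -> G * H) :
  0 < b -> path_pairable a G -> injective pos ->
  #|T| < (a + 1) * (b + 1) -> 2 * #|T| <= #|G| ->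
  exists (c : T -> G) (E : H -> T -> rel G),
  [/\ forall u, routing [set t | (pos t).2 == u] (fun t => (pos t).1) c (E u),
      injective (fun t => (c t, (pos t).2))
    & forall x, #|[set t | c t == x]| <= b].
Proof.
move=> b_gt0 ppG pos_inj ltT leG.
pose heavy := [set x | b < #|[set t | (pos t).1 == x]|].
have le_heavy : #|heavy| <= a.
  (* Each heavy column accounts for at least [b + 1] of the terminals. *)
  suff: #|heavy| * (b + 1) < (a + 1) * (b + 1).
    by rewrite ltn_pmul2r ?addn1 ?ltnS.
  apply: leq_ltn_trans ltT.
  rewrite -sum_nat_const -sum1_card.
  rewrite (partition_big (fun t => (pos t).1) predT) //=.
  rewrite [leqRHS](bigID (mem heavy)) /= (leq_trans _ (leq_addr _ _)) //.
  apply: leq_sum => x; rewrite inE addn1 => /leq_trans->//.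
  by rewrite sum1_card; apply: eq_leq; apply: eq_card => t; rewrite inE.
have [|f f_inj fN] := @fresh_injection T G [set (pos t).1 | t : T].
  by rewrite (leq_trans _ leG) // mul2n -addnn leq_add2l leq_imset_card.
have pos1N t t' : ((pos t).1 == f t') = false.
  by apply: contraNF (fN t') => /eqP <-; apply: imset_f.
pose moved t := (pos t).1 \in heavy.
pose c t := if moved t then f t else (pos t).1.
have pos1_inj u : {in [set t | (pos t).2 == u] &, injective (fun t => (pos t).1)}.
  move=> t t'; rewrite !inE => /eqP t_u /eqP t'_u eq1; apply: pos_inj.
  by rewrite [pos t]surjective_pairing [RHS]surjective_pairing eq1 t_u t'_u.
(* The terminals of row [u] in light columns stay where they are and own no
   edge. *)
have moveE u : exists E,
    routing [set t | (pos t).2 == u] (fun t => (pos t).1) c E.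
  pose D := [set t | (pos t).2 == u & moved t].
  have sub_D t : t \in D -> t \in [set t | (pos t).2 == u].
    by rewrite !inE => /andP[].
  have [|t t' /sub_D Dt /sub_D Dt'|t t' _ _|t t' _ _|E rE] :=
    path_pairable_routing (s := fun t => (pos t).1) (t := f) (D := D) ppG.
  - rewrite (leq_trans _ le_heavy) // -(card_in_imset (f := fun t => (pos t).1)).
      apply/subset_leq_card/subsetP=> _ /imsetP[t + ->].
      by rewrite inE => /andP[].
    by move=> t t' /sub_D Dt /sub_D Dt'; apply: (pos1_inj u).
  - exact: (pos1_inj u).
  - exact: f_inj.
  - by rewrite pos1N.
  exists E; split.
  - exact: routing_sym rE.
  - exact: routing_edge rE.
  - by move=> t x y /(routing_supp rE)/sub_D.
  - move=> t; rewrite inE /c => t_u; case: ifP => [mt|_]; last exact: connect0.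
    by apply: (routing_connect rE); rewrite inE t_u.
  - exact: routing_disjoint rE.
have [E rE] := fin_all_exists moveE.
exists c, E; split=> // [t t'|x].
  rewrite /c => -[+ eq2]; case: ifP => _; case: ifP => _.
  - exact: f_inj.
  - by move/eqP; rewrite eq_sym pos1N.
  - by move/eqP; rewrite pos1N.
  - by move=> eq1; apply: (pos1_inj (pos t).2); rewrite ?inE // eq2.
have [/existsP[t /eqP def_x]|x_old] := boolP [exists t, x == f t].
  rewrite (leq_trans _ b_gt0) // -(cards1 t) subset_leq_card //.
  apply/subsetP=> t'; rewrite !inE /c def_x.
  by case: ifP => _; rewrite ?pos1N // (inj_eq f_inj).
have col_x t : c t == x -> (pos t).1 = x /\ x \notin heavy.
  rewrite /c; case: ifPn => [_ /eqP fx|mt /eqP<-//].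
  by case/negP: x_old; apply/existsP; exists t; rewrite fx.
have [->|[t]] := set_0Vmem [set t | c t == x]; first by rewrite cards0.
rewrite inE => /col_x[_]; rewrite inE -leqNgt; apply: leq_trans.
by apply/subset_leq_card/subsetP=> t'; rewrite !inE => /col_x[->].
Qed.

(** * Edge sets of the Cartesian product *)

Definition cart_rel (G H : sgraph) (R : H -> rel G) (C : G -> rel H) :
    rel (cart_prod G H) := fun p q =>
  (p.2 == q.2) && R p.2 p.1 q.1 || (p.1 == q.1) && C p.1 p.2 q.2.

Section CartRel.
Variables (G H : sgraph) (R : H -> rel G) (C : G -> rel H).

Lemma cart_rel_sym :
  (forall u, symmetric (R u)) -> (forall v, symmetric (C v)) ->
  symmetric (cart_rel R C).
Proof.
move=> R_sym C_sym p q; rewrite /cart_rel (eq_sym q.2) (eq_sym q.1).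
by congr (_ || _); case: eqP => //= ->; [apply: R_sym | apply: C_sym].
Qed.

Lemma cart_rel_edge :
  (forall u, subrel (R u) edge) -> (forall v, subrel (C v) edge) ->
  subrel (cart_rel R C) (@edge (cart_prod G H)).
Proof.
move=> R_edge C_edge p q; rewrite /cart_rel /edge /= /cart_edge.
case/orP=> /andP[-> pq]; first by rewrite (R_edge _ _ _ pq) orbT.
by rewrite (C_edge _ _ _ pq).
Qed.

Lemma connect_row u v v' :
  connect (R u) v v' -> connect (cart_rel R C) (v, u) (v', u).
Proof.
apply: (connect_hom (f := fun z => (z, u))) => z z' zz'.
by rewrite /cart_rel /= eqxx zz'.
Qed.

Lemma connect_col v u u' :
  connect (C v) u u' -> connect (cart_rel R C) (v, u) (v, u').
Proof.
apply: (connect_hom (f := fun z => (v, z))) => z z' zz'.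
by rewrite /cart_rel /= eqxx zz' orbT.
Qed.

End CartRel.

(** Rows and columns never share an edge: the ends of an edge in a row have
    different columns, since [edge] is irreflexive. *)
Lemma cart_rel_disjoint (G H : sgraph) (I : Type)
    (R : I -> H -> rel G) (C : I -> G -> rel H) :
  (forall i u, subrel (R i u) edge) -> (forall i v, subrel (C i v) edge) ->
  (forall i j u v v', R i u v v' -> R j u v v' -> i = j) ->
  (forall i j v u u', C i v u u' -> C j v u u' -> i = j) ->
  forall i j p q,
    cart_rel (R i) (C i) p q -> cart_rel (R j) (C j) p q -> i = j.
Proof.
move=> R_edge C_edge R_dis C_dis i j p q.
case/orP=> /andP[/eqP eq_i pq_i] /orP[]/andP[/eqP eq_j pq_j].
- exact: R_dis pq_i pq_j.
- by have := R_edge _ _ _ _ pq_i; rewrite eq_j edge_irr.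
- by have := R_edge _ _ _ _ pq_j; rewrite eq_i edge_irr.
- exact: C_dis pq_i pq_j.
Qed.

(** * Joining the pairs *)

(** The bound on [2k] limits the heavy columns to [a]; [4k] counts the [2k]
    fresh columns and the at most [2k] occupied ones, [3k] the [k] private rows
    and the at most [2k] occupied ones. *)
Theorem path_pairable_cart_prod a b k (G H : sgraph) :
  0 < a -> 0 < b -> path_pairable a G -> path_pairable b H ->
  2 * k < (a + 1) * (b + 1) -> 4 * k <= #|G| -> 3 * k <= #|H| ->
  path_pairable k (cart_prod G H).
Proof.
move=> a_gt0 b_gt0 ppG ppH ltk leG leH.
apply: routing_path_pairable => [|x y x_inj y_inj xy].
  rewrite card_prod.
  have [->//|k_gt0] := posnP k.
  have H_gt0 : 0 < #|H| by rewrite (leq_trans _ leH) ?muln_gt0.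
  rewrite (leq_trans _ (leq_pmulr _ H_gt0)) // (leq_trans _ leG) //.
  by rewrite leq_mul2r orbT.
(* The terminals: [(i, false)] and [(i, true)] are the two ends of pair [i]. *)
pose T := ('I_k * bool)%type.
pose pos (t : T) : G * H := if t.2 then y t.1 else x t.1.
have pos_inj : injective pos.
  move=> [i [] ] [j [] ] /=; rewrite /pos /=.
  - by move/y_inj->.
  - by move/eqP; rewrite eq_sym (negPf (xy _ _)).
  - by move/eqP; rewrite (negPf (xy _ _)).
  - by move/x_inj->.
have cardT : #|{: T}| = 2 * k by rewrite card_prod card_ord card_bool mulnC.
have [||c [A [rA c_inj le_c]]] := spread_columns b_gt0 ppG pos_inj.
- by rewrite cardT.
- by rewrite cardT mulnA.
have [|w w_inj wN] := @fresh_injection 'I_k H [set (pos t).2 | t : T].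
  rewrite card_ord (leq_trans _ leH) // mulSn leq_add2l -cardT.
  exact: leq_imset_card.
have wF t i : (pos t).2 == w i = false.
  by apply: contraNF (wN i) => /eqP <-; apply: imset_f.
(* A pair whose ends are in the same column makes a single request there, from
   its [false] end to its [true] end; its [true] end is excluded from [D]. *)
pose together i := c (i, false) == c (i, true).
pose goal (t : T) := if together t.1 then (pos (t.1, true)).2 else w t.1.
pose D z := [set t : T | (c t == z) && ~~ (t.2 && together t.1)].
have routeB z : exists B, routing (D z) (fun t => (pos t).2) goal B.
  have D_c t : t \in D z -> c t = z by rewrite inE => /andP[/eqP].
  have row_inj t t' : c t = z -> c t' = z -> (pos t).2 = (pos t').2 -> t = t'.
    by move=> ct ct' eq2; apply: c_inj; rewrite ct ct' eq2.
  apply: path_pairable_routing ppH _ _ _ _.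
  - apply: leq_trans (le_c z); apply/subset_leq_card/subsetP=> t.
    by rewrite !inE => /andP[].
  - by move=> t t' /D_c ct /D_c ct'; apply: row_inj.
  - move=> [i d] [j d'] Di Dj; have ci := D_c _ Di; have cj := D_c _ Dj.
    move: Di Dj; rewrite !inE /goal /=; case: ifPn => ti; case: ifPn => tj.
    + rewrite !andbT => /andP[_ /negPf d0] /andP[_ /negPf d'0]; subst d d'.
      move=> eq2; suff [->] : (i, true) = (j, true) by [].
      by apply: row_inj eq2; rewrite -?(eqP ti) -?(eqP tj).
    + by move=> _ _ /eqP; rewrite wF.
    + by move=> _ _ /eqP; rewrite eq_sym wF.
    + move=> _ _ /w_inj eq_ij; subst j.
      by case: d d' ci cj => [] [] // ci cj; case/negP: ti; rewrite /together ci cj.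
  - move=> t [j d'] Dt Dj; have ct := D_c _ Dt; have cj := D_c _ Dj.
    rewrite /goal /=; case: ifPn => tj; last by rewrite wF.
    move: Dj; rewrite inE /= tj andbT => /andP[_ /negPf d'0]; subst d'.
    apply: contraTneq Dt => /row_inj->//; last by rewrite -(eqP tj).
    by rewrite inE /= tj andbF.
have [B rB] := fin_all_exists routeB.
(* The edges of pair [i] in row [u] and in column [v]. *)
pose R i u v v' := [exists d, A u (i, d) v v'] || (u == w i) && edge v v'.
pose C i v u u' := [exists d, B v (i, d) u u'].
have R_sym i u : symmetric (R i u).
  move=> v v'; rewrite /R edge_sym; congr (_ || _); apply: eq_existsb => d.
  exact: routing_sym (rA u) _ _ _.
have C_sym i v : symmetric (C i v).
  by move=> u u'; apply: eq_existsb => d; apply: routing_sym (rB v) _ _ _.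
have R_edge i u v v' : R i u v v' -> edge v v'.
  by case/orP=> [/existsP[d /(routing_edge (rA u))]|/andP[]].
have C_edge i v u u' : C i v u u' -> edge u u'.
  by case/existsP=> d /(routing_edge (rB v)).
have A_w i t v v' : A (w i) t v v' = false.
  by apply/negP => /(routing_supp (rA _)); rewrite inE wF.
have R_dis i j u v v' : R i u v v' -> R j u v v' -> i = j.
  case/orP=> [/existsP[d Ai]|/andP[/eqP-> _]].
    case/orP=> [/existsP[d' /(routing_disjoint (rA u) Ai)[]//]|/andP[/eqP def_u]].
    by rewrite def_u A_w in Ai.
  case/orP=> [/existsP[d' ]|/andP[/eqP/w_inj]//]; by rewrite A_w.
have C_dis i j v u u' : C i v u u' -> C j v u u' -> i = j.
  by case/existsP=> d Bi /existsP[d' /(routing_disjoint (rB v) Bi)[]].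
pose E i : rel (cart_prod G H) := cart_rel (R i) (C i).
have to_c i d : connect (E i) (pos (i, d)) (c (i, d), (pos (i, d)).2).
  rewrite [pos _ in X in connect _ X _]surjective_pairing; apply: connect_row.
  have := routing_connect (rA (pos (i, d)).2); rewrite -/T => /(_ (i, d)).
  rewrite inE eqxx => /(_ isT); apply: (connect_hom (f := id)) => z z' Az.
  by apply/orP; left; apply/existsP; exists d.
have to_goal i d : ~~ (d && together i) ->
    connect (E i) (c (i, d), (pos (i, d)).2) (c (i, d), goal (i, d)).
  move=> td; apply: connect_col; have := routing_connect (rB (c (i, d))).
  move=> /(_ (i, d)); rewrite inE eqxx td => /(_ isT).
  by apply: (connect_hom (f := id)) => z z' Bz; apply/existsP; exists d.
have E_sym i : symmetric (E i) by apply: cart_rel_sym.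
have E_csym i : connect_sym (E i) by apply: sym_connect_sym.
exists E; split=> //.
- by move=> i; apply: cart_rel_edge; [apply: R_edge | apply: C_edge].
- move=> i _; apply: connect_trans (to_c i false) _.
  rewrite E_csym; apply: connect_trans (to_c i true) _; rewrite E_csym.
  apply: connect_trans (to_goal i false isT) _.
  rewrite /goal /=; case: ifPn => [/eqP->|ti]; first exact: connect0.
  rewrite E_csym; have := to_goal i true; rewrite /goal /= (negPf ti) => /(_ isT).
  move/connect_trans; apply; apply: connect_row.
  apply: (connect_hom (f := id)) (path_pairable_connect a_gt0 ppG _ _).
  by move=> z z' e_z; rewrite /R eqxx e_z orbT.
- exact: cart_rel_disjoint.
Qed.

Theorem corollary1 (a b : nat) (G H : sgraph) :
  0 < a -> 0 < b ->
  path_pairable a G -> path_pairable b H ->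
  2 * ((a + 1) * (b + 1)) - 1 <= #|G| ->
  2 * ((a + 1) * (b + 1)) - 1 <= #|H| ->
  path_pairable (((a + 1) * (b + 1)) %/ 2 - 1) (cart_prod G H).
Proof.
move=> a_gt0 b_gt0 ppG ppH leG leH.
set N := (a + 1) * (b + 1) in leG leH *; set k := N %/ 2 - 1.
(* Hence the subtraction in [k] is not truncated. *)
have N_ge4 : 4 <= N by rewrite (@leq_mul 2 2) ?addn1.
have k_N : 2 * k + 2 <= N by have := leq_divM N 2; lia.
apply: (path_pairable_cart_prod a_gt0 b_gt0 ppG ppH); rewrite -?/N; lia.
Qed.
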